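(* Let $M,n\ge1$ and let $\mathcal A=\{A_1,\dots,A_M\}\subset\mathbb R^{n\times n}_{\ge0}$ be a set of nonnegative matrices. For every integer $l\ge1$, with $\mathcal G^l_{\mathrm{db}}$ the (primal) De Bruijn graph of order $l-1$ on $\langle M\rangle$, $$\frac{1}{\sqrt[l]{n}}\,\rho_{\mathcal D,\mathcal G^l_{\mathrm{db}}}(\mathcal A)\ \le\ \rho(\mathcal A)\ \le\ \rho_{\mathcal D,\mathcal G^l_{\mathrm{db}}}(\mathcal A).$$
   Context: $\langle M\rangle:=\{1,\dots,M\}$. The joint spectral radius of $\mathcal A=\{A_1,\dots,A_M\}$ is $\rho(\mathcal A):=\lim_{k\to\infty}\max_{(i_1,\dots,i_k)\in\langle M\rangle^k}\|A_{i_k}\cdots A_{i_2}A_{i_1}\|^{1/k}$ (independent of the chosen matrix norm). For $l\ge1$, the De Bruijn graph of order $l-1$ on $\langle M\rangle$, $\mathcal G^l_{\mathrm{db}}=(S,E)$, has node set $S=\langle M\rangle^{l-1}$ and labeled directed edges $E\subseteq S\times S\times\langle M\rangle$ given by: for every $a=(i_1,\dots,i_{l-1})\in S$ and every $j\in\langle M\rangle$, $(a,b,j)\in E$ with $b=(i_2,\dots,i_{l-1},j)$. For $l=1$ it is the graph with a single node and one self-loop for each label $j\in\langle M\rangle$. For a graph $\mathcal G=(S,E)$ with $E\subseteq S\times S\times\langle M\rangle$, $$\rho_{\mathcal D,\mathcal G}(\mathcal A):=\inf\big\{\gamma\ge0\ \big|\ \exists\,(v_s)_{s\in S}\subset\mathbb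 R^n_{>0}:\ A_iv_a\le\gamma v_b\ \text{ for all }(a,b,i)\in E\big\},$$ where vector inequalities are componentwise and $\mathbb R^n_{>0}$ is the set of vectors with strictly positive entries. *)

(* Defs.v *)
From HB Require Import structures.
From mathcomp Require Import all_boot all_order all_algebra.
From mathcomp Require Import all_classical all_reals all_analysis.
Set Implicit Arguments.
Unset Strict Implicit.
Unset Printing Implicit Defensive.
Import Order.TTheory GRing.Theory Num.Theory.
Import numFieldNormedType.Exports.
Local Open Scope classical_set_scope.
Local Open Scope ring_scope.

(* The label set <M> = {1, ..., M} is 'I_M, and
   the set {A_1, ..., A_M} is given as an indexed family A : 'I_M -> 'M[R]_n. *)

Definition nonneg_mx (R : realType) (m n : nat) (A : 'M[R]_(m, n)) : Prop :=
  forall i j, 0 <= A i j.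

Definition pos_cv (R : realType) (n : nat) (v : 'cV[R]_n) : Prop :=
  forall i, 0 < v i ord0.

Definition le_cv (R : realType) (n : nat) (u v : 'cV[R]_n) : Prop :=
  forall i, u i ord0 <= v i ord0.

(* Submultiplicativity is not required; nonnegativity follows from the axioms. *)
Record is_norm (R : realType) (V : lmodType R) (N : V -> R) : Prop := IsNorm {
  is_norm_triangle : forall x y, N (x + y) <= N x + N y;
  is_norm_scale : forall (a : R) x, N (a *: x) = `|a| * N x;
  is_norm_definite : forall x, N x = 0 -> x = 0
}.

(* For w = (i_1, ..., i_k): A_{i_k} *m ... *m A_{i_1}. *)
Definition mx_word (R : realType) (M n : nat) (A : 'I_M -> 'M[R]_n)
    (w : seq 'I_M) : 'M[R]_n :=
  foldl (fun P i => A i *m P) 1%:M w.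

(* The k-th root is the real power of exponent k^-1; the term k = 0 is
   irrelevant for the limit. The default value 0 of the maximum is harmless:
   norms are nonnegative. *)
Definition joint_spectral_radius (R : realType) (M n : nat) (N : 'M[R]_n -> R)
    (A : 'I_M -> 'M[R]_n) : R :=
  lim ((fun k : nat =>
    \big[Num.max/0]_(w : k.-tuple 'I_M) (N (mx_word A w) `^ k%:R^-1)) @ \oo).

Record labeled_graph (M : nat) := LabeledGraph {
  node : finType;
  edges : {set node * node * 'I_M}
}.

(* Nodes are the words of length d; for d = 0 the only node is the empty word,
   with one self-loop per label. *)
Definition de_bruijn (M d : nat) : labeled_graph M :=
  @LabeledGraph M (d.-tuple 'I_M)
    [set (a, [tuple of behead (rcons a j)], j) | a : d.-tuple 'I_M, j : 'I_M]%SET.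

Definition rho_D (R : realType) (M n : nat) (G : labeled_graph M)
    (A : 'I_M -> 'M[R]_n) : R :=
  inf [set gamma : R | 0 <= gamma /\
    exists v : node G -> 'cV[R]_n,
      (forall s, pos_cv (v s)) /\
      forall a b i, (a, b, i) \in edges G ->
        le_cv (A i *m v a) (gamma *: v b)].

(* Main.v *)
Require Import Defs.
From HB Require Import structures.
From mathcomp Require Import all_boot all_order all_algebra.
From mathcomp Require Import all_classical all_reals all_analysis.
Set Implicit Arguments.
Unset Strict Implicit.
Unset Printing Implicit Defensive.
Import Order.TTheory GRing.Theory Num.Theory.
Import numFieldNormedType.Exports.
Local Open Scope classical_set_scope.
Local Open Scope ring_scope.

(* The joint spectral radius is the infimum of the t such that the products A_w
   are O(t^|w|), by equivalence of norms and submultiplicativity of the entry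
   sum. A feasible gamma bounds A_w v_a by gamma^|w| v_b along every walk, so it
   is such a t; this gives the upper bound.
   Conversely, if the products are O(t^|w|), then the componentwise supremum v
   of the nonnegative part of the unit ball of an extremal norm for A / t
   satisfies A_w v <= n t^|w| v. With c^l = n t^l, put
     V_a := sum_(k < l) c^-k A_(last k letters of a) v.
   Then A_j V_a and c V_b telescope along an edge (a, b, j), and what is left is
   A_(a j) v <= c^l v, so c is feasible. *)

(** * Norms on matrices and their equivalence with the entry sum *)

Lemma is_norm0 (R : realType) (V : lmodType R) (N : V -> R) :
  is_norm N -> N 0 = 0.
Proof. by move=> hN; rewrite -(scale0r 0) (is_norm_scale hN) normr0 mul0r. Qed.

Lemma is_normN (R : realType) (V : lmodType R) (N : V -> R) x :
  is_norm N -> N (- x) = N x.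
Proof.
by move=> hN; rewrite -scaleN1r (is_norm_scale hN) normrN normr1 mul1r.
Qed.

Lemma is_norm_ge0 (R : realType) (V : lmodType R) (N : V -> R) x :
  is_norm N -> 0 <= N x.
Proof.
move=> hN; have := is_norm_triangle hN x (- x).
by rewrite subrr (is_norm0 hN) (is_normN _ hN) -mulr2n pmulrn_lge0.
Qed.

Lemma is_norm_sum (R : realType) (V : lmodType R) (N : V -> R)
    (I : Type) (r : seq I) (P : pred I) (F : I -> V) :
  is_norm N -> N (\sum_(i <- r | P i) F i) <= \sum_(i <- r | P i) N (F i).
Proof.
move=> hN; elim/big_rec2: _ => [|i y x _ h]; first by rewrite (is_norm0 hN).
by rewrite (le_trans (is_norm_triangle hN _ _))// lerD2l.
Qed.

(** Reference norm: it is submultiplicative, which an arbitrary [N] need not be. *)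
Definition entry_sum (R : realType) (m n : nat) (A : 'M[R]_(m, n)) : R :=
  \sum_i \sum_j `|A i j|.

Lemma entry_sum_ge0 (R : realType) (m n : nat) (A : 'M[R]_(m, n)) :
  0 <= entry_sum A.
Proof. by apply: sumr_ge0 => i _; apply: sumr_ge0. Qed.

Lemma entry_sum_le (R : realType) (m n : nat) (A : 'M[R]_(m, n)) (x : R) :
  (forall i j, `|A i j| <= x) -> entry_sum A <= (m * n)%:R * x.
Proof.
move=> Ax; apply: le_trans (_ : \sum_(i < m) \sum_(j < n) x <= _).
  by apply: ler_sum => i _; apply: ler_sum.
by rewrite !sumr_const !card_ord -mulrnA mulr_natl mulnC.
Qed.

Lemma entry_sum_mul (R : realType) (m n p : nat)
    (A : 'M[R]_(m, n)) (B : 'M[R]_(n, p)) :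
  entry_sum (A *m B) <= entry_sum A * entry_sum B.
Proof.
apply: (@le_trans _ _ (\sum_i \sum_k (\sum_j `|A i j| * `|B j k|))).
  apply: ler_sum => i _; apply: ler_sum => k _; rewrite mxE.
  apply: le_trans (ler_norm_sum _ _ _) _.
  by apply: ler_sum => j _; rewrite normrM.
rewrite mulr_suml; apply: ler_sum => i _; rewrite exchange_big mulr_suml/=.
apply: ler_sum => j _; rewrite -mulr_sumr ler_wpM2l//.
rewrite /entry_sum [leRHS](bigD1 j)//= lerDl.
by apply: sumr_ge0 => k _; apply: sumr_ge0.
Qed.

Lemma is_norm_le_entry_sum (R : realType) (m n : nat) (N : 'M[R]_(m, n) -> R) :
  is_norm N -> exists2 C, 0 < C & forall A, N A <= C * entry_sum A.
Proof.
move=> hN; exists (1 + \sum_i \sum_j N (delta_mx i j)) => [|A].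
  rewrite ltr_pwDl// sumr_ge0// => i _; apply: sumr_ge0 => j _.
  exact: is_norm_ge0.
have le_C i j : N (delta_mx i j) <= 1 + \sum_i \sum_j N (delta_mx i j).
  rewrite (bigD1 i)//= (bigD1 j)//= addrCA -[leLHS]addr0 -addrA lerD2l.
  rewrite !addr_ge0// ?sumr_ge0// => k _; rewrite ?is_norm_ge0//.
  by apply: sumr_ge0 => k' _; apply: is_norm_ge0.
rewrite {1}(matrix_sum_delta A) (le_trans (is_norm_sum _ _ _ hN))// mulr_sumr.
apply: ler_sum => i _; rewrite (le_trans (is_norm_sum _ _ _ hN))// mulr_sumr.
apply: ler_sum => j _; rewrite (is_norm_scale hN) mulrC.
by rewrite ler_wpM2r.
Qed.

Lemma entry_le_mx_norm (R : realType) (m n : nat) (A : 'M[R]_(m, n)) i j :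
  `|A i j| <= `|A|.
Proof.
by rewrite [leRHS]/Num.Def.normr/= mx_normrE; apply/bigmax_geP; right; exists (i, j).
Qed.

Lemma is_norm_continuous (R : realType) (m n : nat) (N : 'M[R]_(m, n) -> R) :
  is_norm N -> continuous N.
Proof.
move=> hN x; have [C C0 NC] := is_norm_le_entry_sum hN.
have Nlip y : `|N x - N y| <= C * (m * n).+1%:R * `|x - y|.
  have NB u v : N u - N v <= N (u - v).
    by rewrite lerBlDr (le_trans _ (is_norm_triangle hN _ _))// subrK.
  apply: (@le_trans _ _ (N (x - y))).
    by rewrite ler_norml NB andbT lerNl opprB -(is_normN (x - y) hN) opprB NB.
  apply: le_trans (NC _) _; rewrite -mulrA ler_wpM2l ?(ltW C0)//.
  apply: le_trans (entry_sum_le (@entry_le_mx_norm _ _ _ _)) _.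
  by rewrite ler_wpM2r// ler_nat.
have D0 : 0 < C * (m * n).+1%:R by rewrite mulr_gt0.
apply/(@cvgrPdist_le _ _ _ _ (nbhs_filter x)) => e e0.
have eD : 0 < e / (C * (m * n).+1%:R) by rewrite divr_gt0.
apply: filterS (nbhsx_ballx x (PosNum eD)%:num _) => //= y.
rewrite -ball_normE/= => /ltW xy; rewrite (le_trans (Nlip y))//.
by rewrite mulrC -ler_pdivlMr.
Qed.

(** [c] is the minimum of [N] on the unit sphere, which is compact; definiteness makes it
    positive. *)
Lemma is_norm_ge_row_norm (R : realType) (n : nat) (N : 'rV[R]_n -> R) :
  is_norm N -> exists2 c, 0 < c & forall x, c * `|x| <= N x.
Proof.
move=> hN; set S := [set x : 'rV[R]_n | `|x| = 1].
have homog x : x != 0 -> S (`|x|^-1 *: x) /\ N x = `|x| * N (`|x|^-1 *: x).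
  move=> x0; have x1 : `|x| != 0 by rewrite normr_eq0.
  split; first by rewrite /S/= normrZ normfV normr_id mulVf.
  by rewrite (is_norm_scale hN) normfV normr_id mulVKf.
(* The sphere is empty when [n = 0]; then every vector is zero. *)
have [[x0 Sx0]|S0] := pselect (S !=set0); last first.
  exists 1 => // x; have [->|/homog[Sx _]] := eqVneq x 0.
    by rewrite normr0 mulr0 (is_norm0 hN).
  by case: S0; exists (`|x|^-1 *: x).
have cS : compact S.
  apply: bounded_closed_compact.
    exists 1; split => [|y y1 x /= ->]; [exact: num_real|exact: ltW].
  have -> : S = Num.norm @^-1` [set x : R | x = 1] by [].
  apply: preimage_closed; last exact: closed_eq.
  by move=> x _; apply: norm_continuous.
have [||x1] := compact_EVT_min (f := N) _ cS.
- by exists x0.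
- by apply: continuous_subspaceT; apply: is_norm_continuous.
rewrite inE => Sx1 x1min; exists (N x1) => [|x].
  rewrite lt_def is_norm_ge0// andbT; apply/eqP => /(is_norm_definite hN) x10.
  by move: Sx1; rewrite /S/= x10 normr0 => /eqP; rewrite eq_sym oner_eq0.
have [->|/homog[Sx ->]] := eqVneq x 0; first by rewrite normr0 mulr0 (is_norm0 hN).
by rewrite mulrC ler_wpM2l// x1min// inE.
Qed.

Lemma is_norm_ge_entry_sum (R : realType) (m n : nat) (N : 'M[R]_(m, n) -> R) :
  is_norm N -> exists2 c, 0 < c & forall A, c * entry_sum A <= N A.
Proof.
move=> hN; have hN' : is_norm (fun x : 'rV[R]_(m * n) => N (vec_mx x)).
  split=> [x y|a x|x]; first by rewrite linearD (is_norm_triangle hN).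
    by rewrite linearZ (is_norm_scale hN).
  by move=> /(is_norm_definite hN) x0; rewrite -(vec_mxK x) x0 linear0.
have [c c0 cN] := is_norm_ge_row_norm hN'.
exists (c / (m * n).+1%:R) => [|A]; first by rewrite divr_gt0.
apply: le_trans (_ : _ <= c * `|mxvec A|) _; last first.
  by rewrite -[A in leRHS]mxvecK.
rewrite -mulrA ler_wpM2l ?(ltW c0)// mulrC ler_pdivrMr// mulrC.
have Ale i j : `|A i j| <= `|mxvec A| by rewrite -mxvecE entry_le_mx_norm.
by rewrite (le_trans (entry_sum_le Ale))// ler_wpM2r// ler_nat.
Qed.

(** * Products along words and their growth rates *)

Lemma mx_word_rcons (R : realType) (M n : nat) (A : 'I_M -> 'M[R]_n) w i :
  mx_word A (rcons w i) = A i *m mx_word A w.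
Proof. by rewrite /mx_word foldl_rcons. Qed.

Lemma mx_word_cat (R : realType) (M n : nat) (A : 'I_M -> 'M[R]_n) w1 w2 :
  mx_word A (w1 ++ w2) = mx_word A w2 *m mx_word A w1.
Proof.
elim/last_ind: w2 => [|w2 i ih]; first by rewrite cats0 mul1mx.
by rewrite -rcons_cat !mx_word_rcons ih mulmxA.
Qed.

Definition word_growth (R : realType) (M n : nat) (A : 'I_M -> 'M[R]_n) : set R :=
  [set t | 0 <= t /\
    exists K, forall w, entry_sum (mx_word A w) <= K * t ^+ size w].

Lemma word_growth_has_lbound (R : realType) (M n : nat) (A : 'I_M -> 'M[R]_n) :
  has_lbound (word_growth A).
Proof. by exists 0 => t []. Qed.

Lemma word_growth_le (R : realType) (M n : nat) (A : 'I_M -> 'M[R]_n) s t :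
  s <= t -> word_growth A s -> word_growth A t.
Proof.
move=> st [s0 [K AK]]; split; first exact: le_trans st.
have K0 : 0 <= K.
  by have := AK [::]; rewrite expr0 mulr1; apply/le_trans/entry_sum_ge0.
exists K => w; rewrite (le_trans (AK w))// ler_wpM2l//.
by rewrite lerXn2r// nnegrE// (le_trans s0).
Qed.

(* Cutting words into blocks of length [k]: this is where the limit defining
   the joint spectral radius is controlled by a single length. *)
Lemma word_growth_of_length (R : realType) (M n k : nat)
    (A : 'I_M -> 'M[R]_n) t :
  0 < t -> (0 < k)%N ->
  (forall w : k.-tuple 'I_M, entry_sum (mx_word A w) <= t ^+ k) ->
  word_growth A t.
Proof.
move=> t0 k0 At; split; first exact: ltW.
(* [K] dominates the normalised entry sum of every word shorter than [k], hence of the remainder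
   left after cutting. *)
pose K := \sum_(r < k) \sum_(w : r.-tuple 'I_M) entry_sum (mx_word A w) / t ^+ r.
exists K => w; have [m] := ubnP (size w); elim: m w => // m ih w wm.
have [wk|kw] := ltnP (size w) k.
  rewrite -ler_pdivrMr ?exprn_gt0// /K (bigD1 (Ordinal wk))//=.
  rewrite (bigD1 (in_tuple w))//= -addrA lerDl addr_ge0// sumr_ge0// => *.
    by rewrite divr_ge0 ?entry_sum_ge0 ?exprn_ge0 ?ltW.
  by rewrite sumr_ge0// => *; rewrite divr_ge0 ?entry_sum_ge0 ?exprn_ge0 ?ltW.
rewrite -(cat_take_drop k w) mx_word_cat (le_trans (entry_sum_mul _ _))//.
rewrite size_cat exprD mulrCA mulrC size_take_min (minn_idPl kw).
have wE : size (take k w) == k by rewrite size_take_min (minn_idPl kw).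
apply: ler_pM; rewrite ?entry_sum_ge0//; first exact: (At (Tuple wE)).
apply: ih; rewrite size_drop -ltnS (leq_trans _ wm)// ltnS.
by rewrite ltn_subrL k0 (leq_trans k0).
Qed.

Lemma word_growth_has_inf (R : realType) (M n : nat) (A : 'I_M -> 'M[R]_n) :
  has_inf (word_growth A).
Proof.
split; last exact: word_growth_has_lbound.
pose t := 1 + \sum_(w : 1.-tuple 'I_M) entry_sum (mx_word A w).
have t1 : 1 <= t by rewrite lerDl sumr_ge0// => *; exact: entry_sum_ge0.
exists t; apply: (@word_growth_of_length _ _ _ 1) => // [|w].
  exact: lt_le_trans t1.
rewrite expr1 /t (bigD1 w)//= addrCA lerDl addr_ge0// sumr_ge0// => *.
exact: entry_sum_ge0.
Qed.

(** * The joint spectral radius as an infimum of growth rates *)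

Lemma powR_invn_cvg1 (R : realType) (c : R) :
  0 < c -> (fun k : nat => c `^ k%:R^-1) @ \oo --> (1 : R).
Proof.
move=> c0; have -> : (fun k : nat => c `^ k%:R^-1) =
    expR \o (fun k : nat => k%:R^-1 * ln c).
  by apply/funext => k /=; rewrite /powR gt_eqF.
rewrite -[X in _ --> X]expR0 -[X in expR X](mul0r (ln c)).
apply: continuous_cvg; first exact: continuous_expR.
apply: cvgMr_tmp; rewrite -(cvg_shiftS (fun k : nat => k%:R^-1 : R)).
exact: cvg_harmonic.
Qed.

(** The [k]-th term is squeezed between rates near the infimum, up to constants whose [k]-th roots
    tend to 1. *)
Lemma joint_spectral_radiusE (R : realType) (M n : nat) (N : 'M[R]_n -> R)
    (A : 'I_M -> 'M[R]_n) :
  is_norm N -> joint_spectral_radius N A = inf (word_growth A).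
Proof.
move=> hN; rewrite /joint_spectral_radius; set u := fun k : nat => _.
set L := inf _.
have [C C0 NC] := is_norm_le_entry_sum hN.
have [c c0 cN] := is_norm_ge_entry_sum hN.
have N0 x : 0 <= N x by exact: is_norm_ge0.
have u0 k : 0 <= u k by apply: bigmax_ge_id.
have upper t : word_growth A t -> exists2 D, 0 < D &
    forall k, (0 < k)%N -> u k <= D `^ k%:R^-1 * t.
  move=> [t0 [K AK]]; have K0 : 0 <= K.
    by have := AK [::]; rewrite expr0 mulr1; apply/le_trans/entry_sum_ge0.
  have D0 : 0 < C * (K + 1) by rewrite mulr_gt0// ltr_wpDl.
  exists (C * (K + 1)) => // k k0.
  apply: bigmax_le => [|w _]; first by rewrite mulr_ge0 ?powR_ge0.
  have -> : t = (t ^+ k) `^ k%:R^-1.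
    by rewrite -powR_mulrn// -powRrM divff ?powRr1// pnatr_eq0 -lt0n.
  rewrite -powRM ?exprn_ge0 ?(ltW D0)//.
  apply: ge0_ler_powR; rewrite ?invr_ge0 ?nnegrE//.
    by rewrite mulr_ge0 ?exprn_ge0 ?(ltW D0).
  rewrite (le_trans (NC _))// -mulrA ler_wpM2l ?(ltW C0)//.
  rewrite (le_trans (AK w))// size_tuple ler_wpM2r ?exprn_ge0//.
  by rewrite lerDl.
have lower t : 0 < t -> t < L -> forall k, (0 < k)%N -> c `^ k%:R^-1 * t <= u k.
  move=> t0 tL k k0.
  (* Otherwise length [k] alone would make [t] a growth rate, although [t < L]. *)
  have [w Aw] : exists w : k.-tuple 'I_M, t ^+ k < entry_sum (mx_word A w).
    apply: contrapT => /forallNP Aw; move: tL; apply/negP; rewrite -leNgt.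
    apply: ge_inf; first exact: word_growth_has_lbound.
    apply: (word_growth_of_length t0 k0) => w.
    by rewrite leNgt; apply/negP; exact: Aw.
  apply: le_trans (le_bigmax _ _ w).
  have -> : t = (t ^+ k) `^ k%:R^-1.
    by rewrite -powR_mulrn ?ltW// -powRrM divff ?powRr1 ?ltW// pnatr_eq0 -lt0n.
  have tk0 : 0 <= t ^+ k by rewrite exprn_ge0 ?ltW.
  rewrite -powRM ?(ltW c0)//.
  apply: ge0_ler_powR; rewrite ?invr_ge0 ?nnegrE//.
    by rewrite mulr_ge0 ?(ltW c0).
  by rewrite (le_trans _ (cN _))// ler_wpM2l ?(ltW c0)// ltW.
apply: cvg_lim => //; apply/cvgrPdist_le => e e0.
have [t Gt tL] := inf_adherent e0 (word_growth_has_inf A).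
have [D D0 uD] := upper _ Gt.
have cvgM1 (d s : R) : 0 < d -> (fun k : nat => d `^ k%:R^-1 * s) @ \oo --> s.
  move=> d0; rewrite -[X in _ --> X]mul1r; apply: cvgMr_tmp.
  exact: powR_invn_cvg1.
have lowere : \forall k \near \oo, L - e <= u k.
  (* [lower] needs a positive rate. If [L - e] is positive, the midpoint [L - e / 2] leaves room for
     the factor [c ^ (1/k)]. *)
  have [Le|Le] := leP (L - e) 0.
    by apply: nearW => k; exact: le_trans (u0 k).
  have sL : L - e / 2 < L by rewrite ltrBlDr ltrDl divr_gt0.
  have es : L - e < L - e / 2 by rewrite ltrD2l ltrN2 gtr_pMr ?invf_lt1 ?ltr1n.
  have s0 := lt_trans Le es.
  near=> k; apply: le_trans (lower _ s0 sL k _).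
    near: k; exact: (cvgr_ge _ (cvgM1 _ (L - e / 2) c0) _ es).
  by near: k; exact: nbhs_infty_gt.
near=> k; rewrite ler_distlC; apply/andP; split; first by near: k.
apply: le_trans (uD k _) _; first by near: k; exact: nbhs_infty_gt.
near: k; exact: (cvgr_le _ (cvgM1 _ t D0) _ tL).
Unshelve. all: by end_near. Qed.

(** * Feasible rates of a graph against growth rates *)

Definition feasible (R : realType) (M n : nat) (G : labeled_graph M)
    (A : 'I_M -> 'M[R]_n) (t : R) : Prop :=
  0 <= t /\ exists v : node G -> 'cV[R]_n,
    (forall s, pos_cv (v s)) /\
    forall a b i, (a, b, i) \in edges G -> le_cv (A i *m v a) (t *: v b).

Lemma mx_word_ge0 (R : realType) (M n : nat) (A : 'I_M -> 'M[R]_n) w :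
  (forall i, nonneg_mx (A i)) -> nonneg_mx (mx_word A w).
Proof.
move=> A0; elim/last_ind: w => [|w i ih] p q; first by rewrite mxE ler0n.
by rewrite mx_word_rcons mxE sumr_ge0// => r _; apply: mulr_ge0; [exact: A0|].
Qed.

Lemma nonneg_mulmx_le (R : realType) (m n : nat) (A : 'M[R]_(m, n))
    (u v : 'cV[R]_n) :
  nonneg_mx A -> le_cv u v -> le_cv (A *m u) (A *m v).
Proof. by move=> A0 uv i; rewrite !mxE ler_sum// => j _; rewrite ler_wpM2l. Qed.

(** Every label leaves every node, so each word labels a walk from the fixed node [a]. *)
Lemma feasible_word_growth (R : realType) (M n : nat) (G : labeled_graph M)
    (A : 'I_M -> 'M[R]_n) t :
  node G -> (forall a i, exists b, (a, b, i) \in edges G) ->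
  (forall i, nonneg_mx (A i)) -> feasible G A t -> word_growth A t.
Proof.
move=> a out A0 [t0 [v [v0 Av]]]; split => //.
have walk w : exists b, le_cv (mx_word A w *m v a) (t ^+ size w *: v b).
  elim/last_ind: w => [|w i [b ih]].
    by exists a => p; rewrite mul1mx expr0 scale1r.
  have [c bc] := out b i; exists c => p.
  rewrite mx_word_rcons size_rcons -mulmxA.
  apply: le_trans (nonneg_mulmx_le (A0 i) ih p) _.
  rewrite -scalemxAr exprSr -scalerA mxE [leRHS]mxE.
  by rewrite ler_wpM2l ?exprn_ge0// Av.
(* [V] bounds the entries at whichever node the walk ends; [W] serves to divide by the entries of
   [v a]. *)
pose V := \sum_b \sum_i v b i ord0; pose W := \sum_i (v a i ord0)^-1.
have leV b i : v b i ord0 <= V.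
  rewrite /V (bigD1 b)//= (bigD1 i)//= -addrA lerDl addr_ge0// sumr_ge0//.
    by move=> j _; apply/ltW/v0.
  by move=> c _; apply: sumr_ge0 => j _; apply/ltW/v0.
have leW i : (v a i ord0)^-1 <= W.
  rewrite /W (bigD1 i)//= lerDl sumr_ge0// => j _.
  by rewrite invr_ge0; apply/ltW/v0.
exists ((n * n)%:R * (V * W)) => w; rewrite -mulrA; apply: entry_sum_le => i j.
have [b Aw] := walk w.
rewrite ger0_norm ?(mx_word_ge0 _ A0)// mulrC mulrA.
have tV0 : 0 <= t ^+ size w * V.
  by rewrite mulr_ge0 ?exprn_ge0// (le_trans (ltW (v0 b i)) (leV b i)).
apply: le_trans (ler_wpM2l tV0 (leW j)).
rewrite ler_pdivlMr; last exact: v0.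
apply: le_trans (_ : (mx_word A w *m v a) i ord0 <= _).
  rewrite mxE (bigD1 j)//= lerDl sumr_ge0// => k _.
  by rewrite mulr_ge0 ?(mx_word_ge0 _ A0)//; apply/ltW/v0.
apply: le_trans (Aw i) _; rewrite mxE ler_wpM2l ?exprn_ge0//.
Qed.

(* [v_j] is the inverse of the norm of the [j]-th basis vector for the extremal
   norm [x |-> sup_w t^-|w| * |A_w x|_1]; the vector [v] is the componentwise
   supremum of the nonnegative part of its unit ball, whence the factor [n]. *)
Lemma common_subinvariant_vector (R : realType) (M n : nat)
    (A : 'I_M -> 'M[R]_n) t :
  0 < t -> word_growth A t -> (forall i, nonneg_mx (A i)) ->
  exists2 v : 'cV[R]_n, pos_cv v &
    forall w, le_cv (mx_word A w *m v) ((n%:R * t ^+ size w) *: v).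
Proof.
move=> t0 [_ [K AK]] A0; have Aw0 w p q : 0 <= mx_word A w p q by exact: mx_word_ge0.
have te0 k : 0 < t ^+ k by rewrite exprn_gt0.
(* The scaled 1-norm of the image of the [j]-th basis vector; its supremum [g j] is the extremal
   norm of that vector. *)
pose c w j := (\sum_p mx_word A w p j) / t ^+ size w.
have c_le j w : c w j <= sup (range (c^~ j)).
  apply: ub_le_sup; last by exists w.
  exists K => _ [w' _ <-]; rewrite /c ler_pdivrMr// (le_trans _ (AK w'))//.
  apply: ler_sum => p _; rewrite (bigD1 j)//= ger0_norm//.
  by rewrite lerDl sumr_ge0.
pose g j := sup (range (c^~ j)).
have g0 j : 0 < g j.
  apply: lt_le_trans (c_le j [::]); rewrite /c expr0 divr1.
  by rewrite (bigD1 j)//= mxE eqxx ltr_pwDl// sumr_ge0// => p _; exact: Aw0.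
(* For the extremal norm, [A_w e_j] dominates [(A_w)_ij e_i] and has norm at most [t^|w|] times that
   of [e_j]; concatenating words shows the latter. *)
have Ag w i j : mx_word A w i j * g i <= t ^+ size w * g j.
  have [->|Aw1] := eqVneq (mx_word A w i j) 0.
    by rewrite mul0r mulr_ge0// ltW.
  have Aw_gt0 : 0 < mx_word A w i j by rewrite lt_def Aw1 Aw0.
  rewrite mulrC -ler_pdivlMr//; apply: ge_sup; first by exists (c [::] i), [::].
  move=> _ [w' _ <-]; rewrite ler_pdivlMr// -ler_pdivrMl//.
  apply: le_trans (c_le j (w ++ w')).
  rewrite {2}/c size_cat exprD invfM [leRHS]mulrCA ler_pM2l ?invr_gt0//.
  rewrite /c mulrAC ler_pM2r ?invr_gt0// mulr_suml; apply: ler_sum => p _.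
  rewrite mx_word_cat mxE (bigD1 i)//= lerDl sumr_ge0// => q _.
  by rewrite mulr_ge0.
exists (\col_j (g j)^-1) => [j|w i]; first by rewrite mxE invr_gt0.
rewrite !mxE mulrAC -mulrA mulr_natl.
rewrite -[n in leRHS]card_ord -sumr_const; apply: ler_sum => j _.
by rewrite mxE ler_pdivrMr// -mulrA ler_pdivlMl// mulrC.
Qed.

Lemma word_growth_feasible (R : realType) (M n d : nat)
    (A : 'I_M -> 'M[R]_n) t c :
  0 < t -> word_growth A t -> (forall i, nonneg_mx (A i)) ->
  0 < c -> n%:R * t ^+ d.+1 <= c ^+ d.+1 ->
  feasible (de_bruijn M d) A c.
Proof.
move=> t0 At A0 c0 tc; split; first exact: ltW.
have [v v0 Av] := common_subinvariant_vector t0 At A0.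
(* [drop (d - k) w] keeps the last [k] letters of a node [w]. *)
pose V (w : seq 'I_M) (k : nat) := c ^- k *: (mx_word A (drop (d - k) w) *m v).
have V0 w k p : 0 <= V w k p ord0.
  rewrite mxE mulr_ge0 ?invr_ge0 ?exprn_ge0 ?(ltW c0)// mxE sumr_ge0// => j _.
  by rewrite mulr_ge0 ?(mx_word_ge0 _ A0)// ltW.
(* The term [k = 0] is [v] itself, which makes the sum strictly positive. *)
exists (fun a : d.-tuple 'I_M => \sum_(k < d.+1) V a k); split => [a p|a b i].
  rewrite summxE (bigD1 ord0)//= ltr_pwDl ?sumr_ge0//.
  by rewrite /V subn0 drop_oversize ?size_tuple// expr0 invr1 scale1r mul1mx.
move=> /imset2P[a' i' _ _ [-> -> ->]] {a b i}; move: a' i' => a i.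
(* Since [k < d], dropping the first letter of [rcons a i] does not touch its last [k + 1]
   letters. *)
have shift (k : 'I_d) : A i *m V a k = c *: V (behead (rcons a i)) k.+1.
  rewrite /V -scalemxAr scalerA exprS invfM mulVKf ?gt_eqF//; congr (_ *: _).
  rewrite mulmxA -mx_word_rcons -drop_rcons ?size_tuple ?leq_subr//.
  by rewrite -drop1 drop_drop addn1 subnSK.
(* By [shift] all terms cancel except [k = d] on the left and [k = 0] on the right. *)
move=> p; rewrite mulmx_sumr big_ord_recr/= big_ord_recl/= scalerDr scaler_sumr.
rewrite mxE [leRHS]mxE addrC; under eq_bigr do rewrite shift.
rewrite lerD2r /V subnn subn0 drop0 drop_oversize; last first.
  by rewrite size_behead size_rcons size_tuple.
rewrite mul1mx expr0 invr1 scale1r -scalemxAr mulmxA -mx_word_rcons.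
rewrite mxE ler_pdivrMl ?exprn_gt0//.
(* The remaining word [rcons a i] has length [d + 1], which is where [n t^(d+1) <= c^(d+1)]
   enters. *)
apply: le_trans (Av _ _) _; rewrite !mxE mulrA -exprSr size_rcons size_tuple.
by rewrite ler_wpM2r// ltW.
Qed.

(** * Both bounds for De Bruijn graphs *)

Theorem theorem8 (R : realType) (M n l : nat)
    (N : 'M[R]_n -> R) (A : 'I_M -> 'M[R]_n) :
  (1 <= M)%N -> (1 <= n)%N -> (1 <= l)%N ->
  is_norm N ->
  (forall i, nonneg_mx (A i)) ->
  (n%:R `^ l%:R^-1)^-1 * rho_D (de_bruijn M l.-1) A
    <= joint_spectral_radius N A
  /\ joint_spectral_radius N A <= rho_D (de_bruijn M l.-1) A.
Proof.
move=> M1 n1 l1 hN A0; rewrite (joint_spectral_radiusE A hN).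
have -> : rho_D (de_bruijn M l.-1) A =
  inf [set t | feasible (de_bruijn M l.-1) A t] by [].
case: l l1 => // d _; rewrite [d.+1.-1]/=.
set r := n%:R `^ _; set L := inf (word_growth A).
have r0 : 0 < r by rewrite powR_gt0// ltr0n.
have rE : r ^+ d.+1 = n%:R.
  by rewrite -powR_mulrn ?powR_ge0// -powRrM mulVf ?powRr1 ?pnatr_eq0.
have L0 : 0 <= L.
  by apply: lb_le_inf; [exact: (word_growth_has_inf A).1|move=> t []].
(* The infimum [L] may be zero or not attained; [L + e] is a positive growth rate. *)
have LeG e : 0 < e -> word_growth A (L + e).
  move=> e0; have [t Gt /ltW tL] := inf_adherent e0 (word_growth_has_inf A).
  exact: word_growth_le Gt.
have feas e : 0 < e -> feasible (de_bruijn M d) A (r * (L + e)).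
  move=> e0; have Le0 : 0 < L + e by rewrite ltr_wpDl.
  apply: (word_growth_feasible Le0 (LeG _ e0) A0); first exact: mulr_gt0.
  by rewrite exprMn rE.
split.
  apply/ler_addgt0Pr => e e0; rewrite ler_pdivrMl//.
  by apply: ge_inf (feas _ e0); exists 0 => t [].
apply: lb_le_inf => [|t ft]; first by exists (r * (L + 1)); exact: feas.
apply: ge_inf; first exact: word_growth_has_lbound.
(* Walks start at a constant word, which exists because [M] is positive. *)
apply: feasible_word_growth A0 ft; first exact: [tuple of nseq d (Ordinal M1)].
move=> a i; exists [tuple of behead (rcons a i)].
by apply/imset2P; exists a i.
Qed.
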